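(* Let $\boldsymbol{p}=(\boldsymbol{p}_1,\dots,\boldsymbol{p}_K)^T$ be a vector of compact real intervals, let $A^{(1)},\dots,A^{(K)}\in\mathbb{R}^{m\times n}$ and $b^{(1)},\dots,b^{(K)}\in\mathbb{R}^m$, and consider the linear interval parametric system $A(p)x=b(p)$, $p\in\boldsymbol{p}$. Then $\Sigma_{unb}\subseteq\Sigma_{ker}$.
   Context: An interval is a set $\boldsymbol{p}_k=[\underline{p}_k,\overline{p}_k]\subset\mathbb{R}$ with real endpoints $\underline{p}_k\le\overline{p}_k$ (degenerate intervals are allowed). $p\in\boldsymbol{p}$ means $p\in\mathbb{R}^K$ with $p_k\in\boldsymbol{p}_k$ for all $k$. The coefficients depend linearly on the parameters: $A(p)=\sum_{k=1}^K p_kA^{(k)}$ and $b(p)=\sum_{k=1}^K p_kb^{(k)}$. The (united) solution set is $\Sigma=\{x\in\mathbb{R}^n : \exists p\in\boldsymbol{p}:\ A(p)x=b(p)\}$. The set of unbounded directions of $\Sigma$ is $\Sigma_{unb}=\{y\in\mathbb{R}^n : \exists x\in\Sigma\ \forall\alpha\ge 0:\ x+\alpha y\in\Sigma\}$. The (united) kernel is $\Sigma_{ker}=\{y\in\mathbb{R}^n : \exists p\in\boldsymbol{p}:\ A(p)y=0\}$. *)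

(* Defs.v *)
From mathcomp Require Import all_boot all_order all_algebra.
From mathcomp Require Import classical_sets reals.

Set Implicit Arguments.
Unset Strict Implicit.
Unset Printing Implicit Defensive.

Import Order.TTheory GRing.Theory Num.Theory.

Local Open Scope classical_set_scope.
Local Open Scope ring_scope.

(* The interval vector is given by its vectors of lower and upper endpoints;
   lo k 0 <= hi k 0 is not built in. *)
Definition box (R : realType) (K : nat) (lo hi : 'cV[R]_K) : set 'cV[R]_K :=
  [set p | forall k : 'I_K, p k 0 \in `[lo k 0, hi k 0]].

(* Used both for A(p), with coefficients in 'M[R]_(m, n), and for b(p), with
   coefficients in 'cV[R]_m = 'M[R]_(m, 1). *)
Definition param (R : realType) (K m n : nat) (C : 'I_K -> 'M[R]_(m, n))
    (p : 'cV[R]_K) : 'M[R]_(m, n) :=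
  \sum_(k < K) p k 0 *: C k.

Definition united_solution_set (R : realType) (K m n : nat)
    (A : 'I_K -> 'M[R]_(m, n)) (b : 'I_K -> 'cV[R]_m) (lo hi : 'cV[R]_K) :
    set 'cV[R]_n :=
  [set x | exists2 p, box lo hi p & param A p *m x = param b p].

Definition unbounded_directions (R : realType) (n : nat) (S : set 'cV[R]_n) :
    set 'cV[R]_n :=
  [set y | exists2 x, S x & forall a : R, 0 <= a -> S (x + a *: y)].

Definition united_kernel (R : realType) (K m n : nat)
    (A : 'I_K -> 'M[R]_(m, n)) (lo hi : 'cV[R]_K) : set 'cV[R]_n :=
  [set y | exists2 p, box lo hi p & param A p *m y = 0].

(* Main.v *)
(* If x + a y lies in the solution set for every a >= 0, then some p_a in the
   box satisfies a A(p_a) y = b(p_a) - A(p_a) x. Over the compact box the norm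
   of A(p) y attains a minimum c and the norm of b(p) - A(p) x a maximum M, so
   a c <= M for all a >= 0. Hence c = 0, and the minimiser puts y in the
   kernel. *)
Require Import Defs.
From mathcomp Require Import all_boot all_order all_algebra.
From mathcomp Require Import classical_sets reals.
From mathcomp Require Import boolp topology normedtype derive.

Set Implicit Arguments.
Unset Strict Implicit.
Unset Printing Implicit Defensive.

Import Order.TTheory GRing.Theory Num.Theory.
Import numFieldNormedType.Exports.

Local Open Scope classical_set_scope.
Local Open Scope ring_scope.

Lemma param_mulmxl (R : realType) (K m n q : nat) (A : 'I_K -> 'M[R]_(m, n))
    (p : 'cV[R]_K) (B : 'M[R]_(n, q)) :
  param A p *m B = param (fun k => A k *m B) p.
Proof.
by rewrite /param mulmx_suml; apply: eq_bigr => k _; rewrite -scalemxAl.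
Qed.

Lemma paramB (R : realType) (K m n : nat) (A B : 'I_K -> 'M[R]_(m, n))
    (p : 'cV[R]_K) :
  param A p - param B p = param (fun k => A k - B k) p.
Proof.
by rewrite /param -sumrB; apply: eq_bigr => k _; rewrite scalerBr.
Qed.

(* Transposed because the library's compactness of products of intervals is
   stated for row vectors. *)
Lemma continuous_norm_param (R : realType) (K m n : nat)
    (A : 'I_K -> 'M[R]_(m, n)) :
  continuous (fun v : 'rV[R]_K => `|param A v^T|).
Proof.
have cA : continuous (fun v : 'rV[R]_K => param A v^T).
  apply: continuous_big => [|k _ v]; first exact: add_continuous.
  rewrite /continuous_at mxE; under eq_fun do rewrite mxE.
  exact: cvgZr_tmp (@coord_continuous R 1 K 0 k v).
by move=> v; exact: cvg_norm (cA v).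
Qed.

Lemma compact_trmx_box (R : realType) (K : nat) (lo hi : 'cV[R]_K) :
  compact [set v : 'rV[R]_K | box lo hi v^T].
Proof.
have -> : [set v : 'rV[R]_K | box lo hi v^T] =
    [set v | forall k, [set` `[lo k 0, hi k 0]] (v ord0 k)].
  by apply/seteqP; split=> v vb k; have := vb k; rewrite /= mxE.
apply: (@rV_compact R K (fun k => [set` `[lo k 0, hi k 0]])) => k.
exact: segment_compact.
Qed.

(** The compactness argument, freed from [x] and [y]: once these are absorbed into the coefficients
    as [A k *m y] and [b k - A k *m x], both sides are linear in the same [p], so their norms are
    continuous on the box. *)
Lemma param_vanishes_on_box (R : realType) (K m n : nat)
    (U W : 'I_K -> 'M[R]_(m, n)) (lo hi : 'cV[R]_K) :
    (forall a : R, 0 <= a ->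
       exists2 p, box lo hi p & a *: param U p = param W p) ->
  exists2 p, box lo hi p & param U p = 0.
Proof.
move=> UW; pose B := [set v : 'rV[R]_K | box lo hi v^T].
have B0 : B !=set0.
  (* The instance [a = 0] supplies the point of the box that the extreme value theorem requires. *)
  by have [p pb _] := UW 0 (lexx _); exists p^T; rewrite /B /= trmxK.
have cB : compact B := compact_trmx_box (lo := lo) (hi := hi).
have cont V := continuous_subspaceT (A := B) (@continuous_norm_param R K m n V).
have [v /set_mem vB vmin] := compact_EVT_min B0 cB (cont U).
have [w _ wmax] := compact_EVT_max B0 cB (cont W).
exists v^T => //; apply/eqP; rewrite -normr_eq0.
apply/negPn/negP => c0; set c := `|param U v^T| in vmin c0.
set M := `|param W w^T| in wmax.
have c_gt0 : 0 < c by rewrite lt_def c0 normr_ge0.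
(* With this factor [a], [a * c = M + 1]; the corresponding [p] has [param W p] of norm at least
   [a * c], above the maximum [M]. *)
have a_ge0 : 0 <= (M + 1) / c by rewrite divr_ge0 ?addr_ge0 ?normr_ge0.
have [p pb eqp] := UW _ a_ge0.
have pB : p^T \in B by rewrite inE /B /= trmxK.
have := wmax _ pB; rewrite trmxK -eqp normrZ ger0_norm // leNgt => /negP; apply.
apply: (@lt_le_trans _ _ ((M + 1) / c * c)).
  by rewrite divfK // ltrDl.
by rewrite ler_wpM2l //; have := vmin _ pB; rewrite trmxK.
Qed.

Theorem theorem2 (R : realType) (K m n : nat)
    (A : 'I_K -> 'M[R]_(m, n)) (b : 'I_K -> 'cV[R]_m)
    (lo hi : 'cV[R]_K) (lo_le_hi : forall k : 'I_K, lo k 0 <= hi k 0) :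
  unbounded_directions (united_solution_set A b lo hi)
    `<=` united_kernel A lo hi.
Proof.
move=> y [x _ ray].
have [a /ray[p pb Ap]|p pb Ap] := @param_vanishes_on_box _ _ _ _
    (fun k => A k *m y) (fun k => b k - A k *m x) lo hi.
  (* Here [Ap] replaces [param b p] by [param A p *m (x + a *: y)], and the terms in [x] cancel. *)
  exists p => //; rewrite -paramB -!param_mulmxl -Ap mulmxDr -scalemxAr.
  by rewrite addrAC subrr add0r.
by exists p => //; rewrite param_mulmxl.
Qed.
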